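(* Let $G$ be a connected graph, let $f:V(G)\to\mathbb{Z}_2$ be a mapping with $\sum_{v\in V(G)} f(v)\equiv 0\pmod 2$, and let $\varepsilon$ be a real number with $0<\varepsilon<1$. Suppose that for every nonempty proper subset $X$ of $V(G)$, $$d_G(X)\ge \begin{cases} 1/\varepsilon & \text{when } \sum_{v\in X} f(v) \text{ is odd},\\ 1/(1-\varepsilon) & \text{when } \sum_{v\in X}(d_G(v)-f(v)) \text{ is odd}.\end{cases}$$ Then $G$ has an $f$-parity factor $F$ such that for each vertex $v$, $$\lfloor \varepsilon d_G(v)\rfloor -1\le d_F(v)\le \lceil \varepsilon d_G(v)\rceil+1.$$ Furthermore, for any given vertex $z$, one may additionally require either $d_F(z)\ge \varepsilon d_G(z)$, or alternatively $d_F(z)\le\varepsilon d_G(z)$ (whichever is chosen).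
   Context: Graphs are finite and may have loops and multiple edges; a loop contributes $2$ to the degree. For a vertex set $X$, $d_G(X)$ denotes the number of edges with exactly one end in $X$. An $f$-parity factor is a spanning subgraph $F$ such that $d_F(v)\equiv f(v)\pmod 2$ for every vertex $v$. *)

(* Defs.v *)
From HB Require Import structures.
From mathcomp Require Import all_boot all_order all_algebra.
From mathcomp Require Import reals.

Set Implicit Arguments.
Unset Strict Implicit.
Unset Printing Implicit Defensive.

Import GRing.Theory Num.Theory.

Local Open Scope ring_scope.

(* Finite graphs with loops and multiple edges. The ordering of the two ends
   of an edge carries no meaning: every notion below is symmetric in them.
   A loop is an edge e with (ends e).1 = (ends e).2. *)
Record multigraph := Multigraph {
  vertex : finType;
  edge : finType;
  ends : edge -> vertex * vertex
}.

Arguments ends {G} e : rename.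

Definition adjacent (G : multigraph) : rel (vertex G) :=
  fun u v => [exists e : edge G, (ends e == (u, v)) || (ends e == (v, u))].

Definition connected_graph (G : multigraph) : Prop :=
  forall u v : vertex G, connect (@adjacent G) u v.

(* A spanning subgraph is identified with its set of edges. A loop at v counts
   for 2, as both of its ends are v. *)
Definition sub_deg (G : multigraph) (F : {set edge G}) (v : vertex G) : nat :=
  (\sum_(e in F) (((ends e).1 == v) + ((ends e).2 == v)))%N.

Definition deg (G : multigraph) (v : vertex G) : nat :=
  sub_deg [set: edge G] v.

Definition cut_deg (G : multigraph) (X : {set vertex G}) : nat :=
  #|[set e : edge G | ((ends e).1 \in X) != ((ends e).2 \in X)]|.

Definition parity_factor (G : multigraph) (f : vertex G -> 'Z_2)
    (F : {set edge G}) : Prop :=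
  forall v : vertex G, (sub_deg F v)%:R = f v.

Definition near_eps_degrees (R : realType) (G : multigraph) (eps : R)
    (F : {set edge G}) : Prop :=
  forall v : vertex G,
    Num.floor (eps * (deg v)%:R) - 1 <= (sub_deg F v)%:Z
      <= Num.ceil (eps * (deg v)%:R) + 1.

(* Main.v *)
Require Import Defs.
From mathcomp Require Import all_boot all_order all_algebra.
From mathcomp Require Import zify ring lra.
From mathcomp Require Import reals.

Set Implicit Arguments.
Unset Strict Implicit.
Unset Printing Implicit Defensive.

Import Order.TTheory GRing.Theory Num.Theory.

(** For each vertex v let b(v) be the integer of the parity of f(v) with
    eps d(v) < b(v) <= eps d(v) + 2, and add a loop at v. A subgraph of the
    extended graph with degrees b(v) restricts to an f-parity factor with
    d_F(v) = b(v) - 2 or b(v), according to whether the loop is used; both values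
    are admissible, and they lie on either side of eps d(v). The weight eps on
    the edges and (b(v) - eps d(v)) / 2 on the loops has degrees b(v), and the
    cut hypotheses put it in the b-factor polytope, so some b-factor lies in its
    support and uses (or avoids) the loop at z as prescribed. That property of
    the b-factor polytope is reduced to perfect matchings by splitting edges in
    two halves and vertices in b(v) copies; a weighted count over the odd sets
    given by the Tutte-Berge formula concludes. *)

(** * The Tutte-Berge formula *)

Section TutteBerge.
Variables (T : finType) (e : rel T).
Hypothesis e_sym : symmetric e.
Implicit Types (V U X : {set T}) (m n : {ffun T -> T}).

(* Matchings are encoded as involutions, whose fixed points are the unmatched
   vertices. *)
Definition matching V m :=
  [forall x, (m (m x) == x) && ((m x != x) ==> (x \in V) && e x (m x))].

Definition missed V m := [set x in V | m x == x].

Lemma matchingP V m :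
  reflect (involutive m /\ forall x, m x != x -> (x \in V) && e x (m x))
          (matching V m).
Proof.
apply: (iffP forallP) => [H|[mK mV] x].
  split=> [x|x mx]; first by case/andP: (H x) => /eqP.
  by case/andP: (H x) => _ /implyP; apply.
by rewrite mK eqxx; apply/implyP/mV.
Qed.

(** The pairs [{x, m x}] partition [X]; the induction removes one pair at a time. *)
Lemma even_stable (m : T -> T) X : involutive m ->
  {in X, forall x, m x \in X} -> {in X, forall x, m x != x} -> ~~ odd #|X|.
Proof.
move=> mK; have [k] := ubnP #|X|; elim: k X => // k IH X ltk mX mN.
have [->|[x xX]] := set_0Vmem X; first by rewrite cards0.
have yX : m x \in X :\ x by rewrite !inE mN ?mX.
have eqX : #|X| = #|X :\ x :\ m x|.+2.
  by rewrite (cardsD1 x X) xX (cardsD1 (m x) (X :\ x)) yX.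
rewrite eqX /= negbK; apply: IH; first by lia.
  move=> y; rewrite !inE => /and3P[ymx yx yX'].
  by rewrite (can_eq mK) yx mX // andbT (inv_eq mK).
by move=> y; rewrite !inE => /and3P[_ _ /mN].
Qed.

Lemma odd_missed V m : matching V m -> odd #|missed V m| = odd #|V|.
Proof.
case/matchingP=> mK mV.
have -> : missed V m = V :\: [set x | m x != x].
  by apply/setP=> x; rewrite !inE negbK andbC.
have sub : [set x | m x != x] \subset V.
  by apply/subsetP=> x; rewrite inE => /mV/andP[].
rewrite -[#|V|](cardsID [set x | m x != x]) (setIidPr sub) oddD.
suff /negPf-> : ~~ odd #|[set x | m x != x]| by [].
apply: (even_stable mK) => x; rewrite !inE // mK eq_sym //.
Qed.

Definition maxmatching V m :=
  matching V m && [forall n, matching V n ==> (#|missed V m| <= #|missed V n|)].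

Lemma maxmatchingP V m :
  reflect (matching V m /\ forall n, matching V n -> #|missed V m| <= #|missed V n|)
          (maxmatching V m).
Proof.
apply: (iffP andP) => -[Mm H]; split=> //.
  by move=> n Mn; apply: (implyP (forallP H n)).
by apply/forallP=> n; apply/implyP/H.
Qed.

Lemma maxmatching_ex V : exists m, maxmatching V m.
Proof.
have M0 : matching V [ffun x => x].
  by apply/matchingP; split=> x; rewrite !ffunE ?eqxx.
exists [arg min_(m < [ffun x => x] | matching V m) #|missed V m|].
by case: arg_minnP => // m Mm Hm; apply/maxmatchingP.
Qed.

(* [x] becomes matched to [y], whose former partner is left unmatched. *)
Definition rematch m x y : {ffun T -> T} :=
  [ffun v => if v == x then y else if v == y then x
             else if v == m y then v else m v].

Lemma rematch_matching V m x y : matching V m -> m x = x -> x != y ->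
  x \in V -> y \in V -> e x y -> matching V (rematch m x y).
Proof.
case/matchingP=> mK mV mx xy xV yV exy; apply/matchingP; split=> v.
  rewrite !ffunE; have [->|vx] := eqVneq v x.
    by rewrite eq_sym (negPf xy) eqxx.
  have [->|vy] := eqVneq v y; first by rewrite eqxx.
  have [vmy|vmy] := eqVneq v (m y).
    rewrite vmy; case: eqP => [emy|_]; first by move: xy; rewrite -mx -emy mK eqxx.
    by rewrite -vmy (negPf vy) vmy eqxx.
  rewrite (can_eq mK) (negPf vy) !(inv_eq mK) mx (negPf vx) (negPf vmy).
  by rewrite mK.
rewrite !ffunE; have [-> _|vx] := eqVneq v x; first by rewrite xV.
have [-> _|vy] := eqVneq v y; first by rewrite yV e_sym.
by have [->|_] := eqVneq v (m y); [rewrite eqxx | apply: mV].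
Qed.

Lemma missed_rematch V m x y : matching V m -> m x = x -> x != y ->
  x \in V -> y \in V ->
  missed V (rematch m x y) \subset
    if m y == y then missed V m :\ x else m y |: missed V m :\ x.
Proof.
case/matchingP=> mK mV mx xy xV yV; apply/subsetP=> v.
rewrite !inE ffunE => /andP[vV].
have [->|vx] := eqVneq v x; first by rewrite eq_sym (negPf xy).
have [->|vy] := eqVneq v y; first by rewrite (negPf xy).
have [vmy _|vmy mv] := eqVneq v (m y).
  by rewrite -vmy (negPf vy) !inE eqxx.
by case: ifP => _; rewrite !inE vV mv vx ?orbT.
Qed.

(** Rematching covers [x] and can uncover only the former partner of [y]. Were [y] unmatched,
    strictly fewer vertices would be missed; otherwise the number missed does not grow. *)
Lemma maxmatching_rematch V m x y : maxmatching V m -> m x = x -> x != y ->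
  x \in V -> y \in V -> e x y -> m y != y /\ maxmatching V (rematch m x y).
Proof.
case/maxmatchingP=> Mm Hm mx xy xV yV exy.
have Mn := rematch_matching Mm mx xy xV yV exy.
have := subset_leq_card (missed_rematch Mm mx xy xV yV).
have xm : x \in missed V m by rewrite inE xV mx /=.
have := Hm _ Mn; have Dx := cardsD1 x (missed V m); rewrite xm in Dx.
case: eqP => [_|my]; first by lia.
move=> le1 le2; split=> //; apply/maxmatchingP; split=> // n Mn'.
have := Hm _ Mn'; move: le2; rewrite cardsU1; lia.
Qed.

(** Gallai's relation: when every vertex is missed by some maximum matching, its union with equality
    is an equivalence, whose classes serve as the odd sets. *)
Definition indep V x y :=
  [forall m, maxmatching V m ==> ~~ ((x \in missed V m) && (y \in missed V m))].

Lemma indepP V x y :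
  reflect (forall m, maxmatching V m -> x \in missed V m -> y \notin missed V m)
          (indep V x y).
Proof.
apply: (iffP forallP) => H m; last first.
  by apply/implyP=> /H{}H; apply/negP=> /andP[/H/negP].
by move=> Mm xm; have /implyP/(_ Mm) := H m; rewrite xm.
Qed.

Lemma indep_sym V : symmetric (indep V).
Proof. by move=> x y; apply: eq_forallb => m; rewrite [X in ~~ X]andbC. Qed.

Lemma indep_adj V x y : x != y -> x \in V -> y \in V -> e x y -> indep V x y.
Proof.
move=> xy xV yV exy; apply/indepP=> m Mm; rewrite inE xV /= => /eqP mx.
have [my _] := maxmatching_rematch Mm mx xy xV yV exy.
by rewrite inE yV.
Qed.

(* Gallai's exchange argument: if [m] missed both [x] and [y], then among the
   maximum matchings missing [t] the one closest to [m] could be rematched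
   along an edge of [m]. *)
Lemma indep_trans V x t y m0 : maxmatching V m0 -> t \in missed V m0 ->
  indep V x t -> indep V t y -> x != y -> indep V x y.
Proof.
move=> M0 t0 xt ty xy; apply/indepP=> m Mm xm; apply/negP=> ym.
have [mM Hm] := maxmatchingP _ _ Mm; have [mK mV] := matchingP _ _ mM.
pose agree n := #|[set v | (m v == n v) && (n v != v)]|.
have P0 : maxmatching V m0 && (t \in missed V m0) by rewrite M0.
case: (@arg_maxnP _ m0 (fun n => maxmatching V n && (t \in missed V n)) agree P0).
move=> n /andP[Mn tn] nmax.
have [nM Hn] := maxmatchingP _ _ Mn; have [nK nV] := matchingP _ _ nM.
have xn : x \notin missed V n.
  by apply: contraL tn => xn; apply: (indepP _ _ _ xt).
have yn : y \notin missed V n by apply: (indepP _ _ _ ty).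
have eqmn : #|missed V m| = #|missed V n|.
  by apply/eqP; rewrite eqn_leq Hm ?Hn.
have [z zt] : exists z, z \in (missed V n :\: missed V m) :\ t.
  apply/set0Pn; rewrite -card_gt0.
  have : 1 < #|missed V n :\: missed V m|.
    have : [set x; y] \subset missed V m :\: missed V n.
      by apply/subsetP=> v /set2P[]->; rewrite inE ?xm ?ym ?xn ?yn.
    by move/subset_leq_card; rewrite cards2 xy !cardsD setIC eqmn.
  by rewrite (cardsD1 t); case: (t \in _) => [//|/ltnW].
case/setD1P: zt => zt /setDP[]; rewrite !inE => /andP[zV /eqP nz].
rewrite zV /= => mz; have /andP[_ ezw] := mV _ mz.
have mw : m (m z) != m z by rewrite mK eq_sym.
have /andP[wV _] := mV _ mw; set w := m z in mw wV ezw mz.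
have zw : z != w by rewrite eq_sym.
have [nw Mn'] := maxmatching_rematch Mn nz zw zV wV ezw.
have tn' : t \in missed V (rematch n z w).
  move: tn; rewrite !inE ffunE => /andP[tV /eqP nt]; rewrite tV [t == z]eq_sym (negPf zt).
  have [tw|tw] := eqVneq t w; first by rewrite -tw nt eqxx in nw.
  by case: ifP => _; rewrite ?nt eqxx.
suff lt : agree n < agree (rematch n z w).
  by have := nmax (rematch n z w); rewrite Mn' tn' /= leqNgt lt => /(_ isT).
apply: proper_card; apply/properP; split.
  apply/subsetP=> v; rewrite !inE !ffunE => /andP[/eqP mv nv].
  have [vz|vz] := eqVneq v z; first by rewrite vz nz eqxx in nv.
  have [vw|vw] := eqVneq v w.
    by have -> : m v = z; [rewrite vw mK | rewrite eqxx eq_sym].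
  have [vnw|vnw] := eqVneq v (n w).
    by case/negP: vz; rewrite -(can_eq mK) mv vnw nK.
  by rewrite mv eqxx.
by exists z; rewrite !inE ?ffunE ?eqxx ?nz ?eqxx ?andbF //= eq_sym zw.
Qed.

(* [P] plays the role of the odd components of [V :\: U]: the sets in [P]
   need not be connected. *)
Theorem tutte_berge V : exists m U (P : {set {set T}}),
  [/\ matching V m, trivIset P,
      forall X, X \in P -> [/\ odd #|X|, X \subset V :\: U
         & forall x y, x \in X -> y \in V -> e x y -> y \in X :|: U]
    & #|missed V m| + #|U| <= #|P|].
Proof.
have [k] := ubnP #|V|; elim: k V => // k IH V ltk.
have [m Mm] := maxmatching_ex V; have [mM Hm] := maxmatchingP _ _ Mm.
(* Either some [v] is covered by all maximum matchings, and it is deleted and put in [U]; or every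
   vertex can be missed, and Gallai's classes work with [U] empty. *)
have [/exists_inP[v vV /forallP cov]|all_miss] := boolP
  [exists v in V, forall n, maxmatching V n ==> (v \notin missed V n)].
  have ltV : #|V :\ v| < k by rewrite (cardsD1 v V) vV in ltk *.
  have [n [U [P [nM tP HP leP]]]] := IH _ ltV.
  have [nK nV] := matchingP _ _ nM.
  have nMV : matching V n.
    apply/matchingP; split=> // x /nV; rewrite !inE => /andP[/andP[_ ->] ->] //.
  have nv : n v == v by apply: contraT => /nV; rewrite !inE eqxx.
  have missE : #|missed V n| = #|missed (V :\ v) n|.+1.
    rewrite (cardsD1 v) inE vV nv; congr (_.+1).
    by apply: eq_card => x; rewrite !inE andbA.
  exists m, (v |: U), P; split=> //.
    move=> X /HP[oX sX nX]; split=> //.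
      by apply: (subset_trans sX); apply/subsetP=> x; rewrite !inE negb_or;
      case/and3P=> -> -> ->.
    move=> x y xX yV exy; have [->|yv] := eqVneq y v; first by rewrite !inE eqxx orbT.
    have := nX x y xX _ exy; rewrite !inE yv yV => /(_ isT)/orP[->|->] //.
    by rewrite !orbT.
  have : #|missed V m| < #|missed V n|.
    rewrite ltnNge; apply/negP=> le; have /implyP := cov n.
    rewrite inE vV nv /=; move=> H; suff : false by []; apply: H.
    apply/maxmatchingP; split=> // n' /Hm; exact: leq_trans.
  (* Equal parity turns the strict inequality into a gap of at least 2: one unit pays for [v] being
     missed by [n], the other for [v] joining [U]. *)
  have := odd_missed mM; rewrite -(odd_missed nMV) missE => par lt.
  have := cardsU1 v U; move: par lt leP; case: (v \notin U) => /=; lia.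
have missing v : v \in V -> exists2 n, maxmatching V n & v \in missed V n.
  move=> vV; have /exists_inPn/(_ v vV)/forallPn[n] := all_miss.
  by rewrite negb_imply negbK => /andP[]; exists n.
pose E x y := (x == y) || indep V x y.
have Eeq : {in V & &, equivalence_rel E}.
  move=> x y z xV yV zV; rewrite /E eqxx; split=> // /predU1P[->//|xy].
  have [n Mn yn] := missing y yV; have [n' Mn' xn'] := missing x xV.
  apply/predU1P/predU1P=> -[].
  - by move<-; right; rewrite indep_sym.
  - move=> xz; have [|yz] := eqVneq y z; [by left | right].
    by apply: (indep_trans Mn' xn') yz; rewrite ?(indep_sym _ y).
  - by move<-; right.
  - move=> yz; have [|xz] := eqVneq x z; [by left | right].
    by apply: (indep_trans Mn yn) xz.
have /and3P[/eqP cP tP P0] := equivalence_partitionP Eeq.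
set P := equivalence_partition E V in cP tP P0.
have eqb X x y : X \in P -> x \in X -> y \in V -> (y \in X) = E x y.
  move=> XP xX yV; have xV : x \in V by rewrite -cP; apply/bigcupP; exists X.
  rewrite -(def_pblock tP XP xX); exact: pblock_equivalence_partition Eeq _ _ xV yV.
have sPV X x : X \in P -> x \in X -> x \in V.
  by move=> XP xX; rewrite -cP; apply/bigcupP; exists X.
have nbr X x y : X \in P -> x \in X -> y \in V -> e x y -> y \in X.
  move=> XP xX yV exy; rewrite (eqb X x) // /E; have [//|xy] := eqVneq x y.
  by rewrite indep_adj ?orbT // (sPV X).
exists m, set0, P; split=> //.
- move=> X XP; split; last first.
  + by move=> x y xX yV exy; rewrite setU0; apply: nbr exy.
  + by rewrite setD0; apply/subsetP=> x; apply: sPV.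
  have [X0|[x xX]] := set_0Vmem X; first by rewrite -X0 XP in P0.
  have xV := sPV X x XP xX.
  have [n Mn xn] := missing x xV; have [nM _] := maxmatchingP _ _ Mn.
  have [nK nV] := matchingP _ _ nM.
  have nx : n x = x by move: xn; rewrite inE => /andP[_ /eqP].
  (* A maximum matching missing [x] covers the rest of the class of [x], and does so within the
     class since adjacent vertices are equivalent. *)
  rewrite (cardsD1 x) xX /=; suff H : {in X :\ x, forall y, n y != y}.
    apply: (even_stable nK) (H) => y; rewrite !inE => /andP[yx yX].
    have ny : n y != y by apply: H; rewrite !inE yx.
    have /andP[yV eyn] := nV _ ny.
    rewrite (inv_eq nK) nx yx (nbr X y) //.
    have /nV/andP[] // : n (n y) != n y by rewrite nK eq_sym.
  move=> y /setD1P[yx yX]; have := eqb X x y XP xX (sPV _ _ XP yX).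
  rewrite yX /E eq_sym (negPf yx) /= => /esym/indepP/(_ n Mn xn).
  by rewrite inE (sPV X).
rewrite cards0 addn0.
(* Vertices missed by the same maximum matching are unrelated, so they lie in distinct classes. *)
have inj : {in missed V m &, injective (pblock P)}.
  move=> x y xm ym eqxy; apply/eqP; apply: contraT => xy.
  have [xV yV] : x \in V /\ y \in V.
    by move: xm ym; rewrite !inE => /andP[-> _] /andP[-> _].
  have := pblock_equivalence_partition Eeq xV yV; rewrite -/P eqxy mem_pblock cP yV.
  by rewrite /E (negPf xy) => /esym/indepP/(_ m Mm xm); rewrite ym.
rewrite -(card_in_imset inj); apply/subset_leq_card/subsetP=> _ /imsetP[x xm ->].
by apply: pblock_mem; rewrite cP; move: xm; rewrite inE => /andP[].
Qed.

End TutteBerge.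

(** * Weighted perfect matchings *)

Local Open Scope ring_scope.

(** [w] is a fractional perfect matching obeying Edmonds' odd-cut inequalities. Tutte-Berge is
    applied to its support with [a] and [b] deleted: each odd set sends weight at least 1 into [U
    :|: [set a; b]], which absorbs at most [#|U| + 2] minus the positive weight of [a b] inside it.
    Hence [#|P| < #|U| + 2]; at most one vertex is missed, and by parity none. *)
Lemma exists_perfect_matching_through (R : realDomainType) (T : finType)
    (w : T -> T -> R) (a b : T) :
  (forall x y, w x y = w y x) -> (forall x y, 0 <= w x y) ->
  (forall x, \sum_y w x y = 1) ->
  (forall X : {set T}, odd #|X| -> 1 <= \sum_(x in X) \sum_(y in ~: X) w x y) ->
  a != b -> 0 < w a b ->
  exists m : T -> T,
    [/\ involutive m, forall x, m x != x, forall x, 0 < w x (m x) & m a = b].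
Proof.
move=> wC w0 w1 cut ab wab.
pose V := ~: [set a; b].
have [x y|m [U [P [Mm tP HP leP]]]] := @tutte_berge T (fun x y => 0 < w x y) _ V.
  by rewrite wC.
have [mK mV] := matchingP _ _ _ Mm.
pose S := U :|: [set a; b].
have PS X x y : X \in P -> x \in X -> y \in ~: X -> y \notin S -> w x y = 0.
  move=> XP xX yX yS; apply: contraTeq yX => wxy; rewrite inE negbK.
  move: yS; rewrite inE negb_or => /andP[yU yab].
  have [_ _ /(_ x y xX)] := HP _ XP; rewrite inE yab lt0r wxy w0 => /(_ isT isT).
  by rewrite inE (negPf yU) orbF.
have PdS X x : X \in P -> x \in X -> x \notin S.
  move=> XP xX; have [_ /subsetP/(_ x xX) + _] := HP _ XP.
  by rewrite /S /V !inE => /andP[/negPf-> /negPf->].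
have S2 : (#|S| <= #|U| + 2)%N.
  by rewrite (leq_trans (leq_card_setU _ _)) // leq_add2l cards2; case: (_ != _).
have sumP : (#|P|%:R : R) <= \sum_(x in ~: S) \sum_(y in S) w x y.
  rewrite -sum1_card natr_sum.
  apply: (@le_trans _ _ (\sum_(X in P) \sum_(x in X) \sum_(y in S) w x y)).
    apply: ler_sum => X XP; have [oX _ _] := HP _ XP.
    apply: (le_trans (cut X oX)); apply: ler_sum => x xX.
    rewrite (bigID (mem S)) /= [X in _ + X]big1 ?addr0; last first.
      by move=> y /andP[]; apply: PS.
    rewrite [leRHS](bigID (mem (~: X))) /=.
    under eq_bigl => y do rewrite andbC.
    by rewrite lerDl sumr_ge0.
  rewrite -big_trivIset //=.
  rewrite [leRHS](bigID (mem (cover P))) /=.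
  rewrite (eq_bigl (fun x => (x \in ~: S) && (x \in cover P))).
    by rewrite lerDl sumr_ge0 // => x _; apply: sumr_ge0.
  move=> x /=; rewrite inE; case: bigcupP => [[X XP xX]|]; last by rewrite andbF.
  by rewrite (PdS X).
have sumS : \sum_(x in ~: S) \sum_(y in S) w x y
            = #|S|%:R - \sum_(y in S) \sum_(x in S) w x y.
  rewrite exchange_big /= -sum1_card natr_sum -sumrB; apply: eq_bigr => y _.
  under eq_bigr do rewrite wC; under [X in _ = _ - X]eq_bigr do rewrite wC.
  by rewrite -(w1 y) [X in X - _](bigID (mem S)) /= addrAC subrr add0r;
    apply: eq_bigl => x; rewrite inE.
have inS : w a b + w b a <= \sum_(y in S) \sum_(x in S) w x y.
  have aS : a \in S by rewrite !inE eqxx orbT.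
  have bS : b \in S by rewrite !inE eqxx !orbT.
  have row c d : d \in S -> w d c <= \sum_(x in S) w x c.
    by move=> dS; rewrite (bigD1 d) //= lerDl sumr_ge0.
  rewrite (bigD1 b) //= [X in _ <= _ + X](bigD1 a) /= ?aS //.
  apply: lerD; first exact: row aS.
  apply: (le_trans (row a b bS)); rewrite lerDl.
  by apply: sumr_ge0 => x _; apply: sumr_ge0.
have ltP : (#|P| < #|U| + 2)%N.
  have : (#|P|%:R : R) < (#|U| + 2)%:R.
    apply: (le_lt_trans sumP); rewrite sumS.
    rewrite ltrBlDr (@le_lt_trans _ _ (#|U| + 2)%:R) ?ler_nat // ltrDl.
    by rewrite (lt_le_trans _ inS) // addr_gt0 // wC.
  by rewrite ltr_nat.
(* The cut of the whole of [T] is empty, which the cut condition forbids for an odd set. *)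
have evT : ~~ odd #|T|.
  apply/negP; rewrite -cardsT => /cut; apply/negP; rewrite -ltNge.
  by rewrite big1 // => x _; rewrite setCT big_set0.
have missE : missed V m = set0.
  apply/eqP; rewrite -cards_eq0; have := odd_missed Mm.
  have := cardsC [set a; b]; rewrite cards2 ab -/V => cV.
  by move: leP ltP evT cV; set k := #|missed V m|; case: k => [|[|k]] //; lia.
have mN x : x \in V -> m x != x.
  by move=> xV; apply/eqP=> mx; have := in_set0 x; rewrite -missE inE xV mx eqxx.
have mab x : x \notin V -> m x = x.
  by move=> xV; apply/eqP; apply: contraNT xV => /mV/andP[].
have ba : b != a by rewrite eq_sym.
have aV : a \notin V by rewrite !inE eqxx.
have bV : b \notin V by rewrite !inE eqxx orbT.
exists (fun x => if x == a then b else if x == b then a else m x).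
have mxV x : x \in V -> m x \in V.
  by move=> /mN mx; have /mV/andP[] : m (m x) != m x by rewrite mK eq_sym.
have inV x : x != a -> x != b -> x \in V by move=> xa xb; rewrite !inE negb_or xa.
split=> [x|x|x|]; last by rewrite eqxx.
- have [->|xa] := eqVneq x a; first by rewrite (negPf ba) eqxx.
  have [->|xb] := eqVneq x b; first by rewrite eqxx.
  have := mxV _ (inV _ xa xb); rewrite !inE negb_or => /andP[/negPf-> /negPf->].
  exact: mK.
- have [->//|xa] := eqVneq x a; have [->//|xb] := eqVneq x b.
  exact/mN/inV.
- have [->//|xa] := eqVneq x a; have [->|xb] := eqVneq x b; first by rewrite wC.
  by have /andP[] := mV _ (mN _ (inV _ xa xb)).
Qed.

(** * The b-factor polytope *)

Lemma exists_fibers (V : finType) (b : V -> nat) :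
  exists (K : finType) (kappa : K -> V),
    forall v, #|[set k | kappa k == v]| = b v.
Proof.
exists {v : V & 'I_(b v)}, tag => v.
rewrite -[RHS]card_ord -cardsT.
rewrite -(card_imset [set: 'I_(b v)] (f := Tagged (fun v => 'I_(b v)))); last first.
  by move=> i j /eqP; rewrite eq_Tagged => /eqP.
apply: eq_card => -[u i]; rewrite inE /=; apply/eqP/imsetP => [uv|[j _ /(congr1 tag)]//].
by case: _ / uv; exists i; rewrite ?inE.
Qed.

Lemma big_pair_bool (S : Type) (idx : S) (op : Monoid.com_law idx) (I : finType)
    (F : I * bool -> S) :
  \big[op/idx]_h F h = \big[op/idx]_i op (F (i, false)) (F (i, true)).
Proof.
rewrite (eq_bigr (fun h => F (h.1, h.2))) => [|[]//].
rewrite -(pair_bigA _ (fun i s => F (i, s))); apply: eq_bigr => i _.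
by rewrite big_bool Monoid.mulmC.
Qed.

Section BFactor.
Variables (R : realFieldType) (V L : finType) (en : L -> bool -> V).
Variables (p : L -> R) (b : V -> nat).

Definition boundary (Y : {set V}) :=
  [set l | (en l false \in Y) != (en l true \in Y)].

(** A pair [(l, s)] stands for the half of the link [l] at its end [en l s]. *)
Let anchor (h : L * bool) := en h.1 h.2.
Let flip (h : L * bool) := (h.1, ~~ h.2).

Hypothesis p0 : forall l, 0 <= p l.
Hypothesis p1 : forall l, p l <= 1.
Hypothesis p_deg : forall v, \sum_(h | anchor h == v) p h.1 = (b v)%:R.
(** The number of boundary links in a b-factor has the parity of the sum of [b] over [Y]. So the
    b-factor cannot meet the boundary exactly in [D]: it differs there from [D] in at least one
    link. *)
Hypothesis p_cut : forall (Y : {set V}) (D : {set L}), D \subset boundary Y ->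
  odd (\sum_(v in Y) b v + #|D|) ->
  1 <= \sum_(l in boundary Y :\: D) p l + \sum_(l in D) (1 - p l).

Let p_b0 h : b (anchor h) = 0%N -> p h.1 = 0.
Proof.
move=> bh; have := p_deg (anchor h); rewrite bh.
by move/psumr_eq0P => H; apply: (H (fun h _ => p0 h.1)).
Qed.

Let p_div h : (b (anchor h))%:R * (p h.1 / (b (anchor h))%:R) = p h.1.
Proof.
have [b0|b0] := eqVneq (b (anchor h)) 0%N; first by rewrite p_b0 // mul0r mulr0.
by rewrite mulrCA divff ?mulr1 // pnatr_eq0.
Qed.

Variables (K : finType) (kappa : K -> V).
Hypothesis card_kappa : forall v, #|[set k | kappa k == v]| = b v.

Let T : finType := (K + L * bool)%type.

(* Perfect matchings in the support of [wt] encode b-factors: a link belongs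
   to the factor when its two halves are matched to copies of their anchors,
   and does not when they are matched to each other. The quotient is never
   taken at [b (anchor h) = 0], since then [h] has no copies to be joined to. *)
Let wt (x y : T) : R :=
  match x, y with
  | inl k, inr h | inr h, inl k =>
      if anchor h == kappa k then p h.1 / (b (anchor h))%:R else 0
  | inr h, inr h' => if h' == flip h then 1 - p h.1 else 0
  | inl _, inl _ => 0
  end.

Let flipK : involutive flip.
Proof. by case=> l s; rewrite /flip /= negbK. Qed.

Let wtC x y : wt x y = wt y x.
Proof.
case: x y => [k|h] [k'|h'] //=; rewrite -(inv_eq flipK) eq_sym.
by case: eqP => // ->.
Qed.

Let wt0 x y : 0 <= wt x y.
Proof.
case: x y => [k|h] [k'|h'] //=; case: eqP => // _; rewrite ?divr_ge0 //.
by rewrite subr_ge0.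
Qed.

(** A copy of [v] receives [b v / b v] from the halves at [v]; a half gives [p] in all to the copies
    of its anchor and [1 - p] to its other half. *)
Let wt1 x : \sum_y wt x y = 1.
Proof.
rewrite big_sumType /=; case: x => [k|h] /=.
  rewrite big1 // add0r -big_mkcond /=.
  transitivity (\sum_(h | anchor h == kappa k) p h.1 / (b (kappa k))%:R).
    by apply: eq_bigr => h /eqP->.
  rewrite -mulr_suml p_deg divff // pnatr_eq0 -card_kappa cards_eq0.
  by apply/set0Pn; exists k; rewrite inE.
rewrite -!big_mkcond /= big_pred1_eq sumr_const.
rewrite -[X in _ *+ X](_ : b (anchor h) = _); last first.
  by rewrite -card_kappa; apply: eq_card => k; rewrite !inE eq_sym.
by rewrite -[_ *+ _]mulr_natl p_div addrC subrK.
Qed.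

Section Cut.
Variable X : {set T}.

Let nin v := #|[set k | (kappa k == v) && (inl k \in X)]|.
Let nout v := #|[set k | (kappa k == v) && (inl k \notin X)]|.
(** The cut weight charged to [h]: its edges to copies on the other side of [X], and the edge to its
    other half when only [h] lies in [X]. *)
Let cost h : R :=
  (if inr h \in X then nout (anchor h) else nin (anchor h))%:R
    * (p h.1 / (b (anchor h))%:R)
  + ((inr h \in X) && (inr (flip h) \notin X))%:R * (1 - p h.1).

Let cut_cost : \sum_(x in X) \sum_(y in ~: X) wt x y = \sum_h cost h.
Proof.
rewrite big_sumType /=.
under eq_bigr => k _ do rewrite big_sumType /= big1 // add0r.
under [X in _ + X]eq_bigr => h _ do rewrite big_sumType /=.
rewrite exchange_big big_split /= addrA.
rewrite /cost big_split /=; congr (_ + _).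
  rewrite addrC [RHS](bigID (fun h => inr h \in X)) /=; congr (_ + _).
    apply: eq_bigr => h hX; rewrite hX -big_mkcondr /= sumr_const mulr_natl.
    congr (_ *+ _); apply: eq_card => k.
    by rewrite !inE unfold_in /= inE andbC eq_sym.
  apply: eq_big => [h|h]; rewrite inE // => /negPf hX.
  rewrite hX -big_mkcondr /= sumr_const mulr_natl.
  by congr (_ *+ _); apply: eq_card => k; rewrite !inE unfold_in /= andbC eq_sym.
rewrite [RHS](bigID (fun h => inr h \in X)) /= [X in _ + X]big1 ?addr0; last first.
  by move=> h /negPf->; rewrite mul0r.
apply: eq_bigr => h ->; rewrite -big_mkcondr /=.
case: (boolP (inr (flip h) \in X)) => hX /=.
  rewrite mul0r big_pred0 // => h'; rewrite inE.
  by case: eqP => [->|_]; rewrite ?andbF // hX.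
rewrite mul1r (big_pred1 (flip h)) // => h' /=; rewrite inE.
by case: eqP => [->|]; rewrite ?andbF ?hX.
Qed.

Let ninout v : (nin v + nout v)%N = b v.
Proof.
rewrite -card_kappa -(cardsID [set k | inl k \in X]) /nin /nout.
by congr (_ + _)%N; apply: eq_card => k; rewrite !inE // andbC.
Qed.

Let cost0 h : 0 <= cost h.
Proof.
by rewrite addr_ge0 // mulr_ge0 // ?divr_ge0 // subr_ge0.
Qed.

(** If [X] splits the copies of no vertex, it consists of all copies of the vertices of some [Y] and
    of some halves. Let [Z] be the links with exactly one half in [X]. If [Z] lies in the boundary
    of [Y], the cost dominates the bound of [p_cut] for [Y] and [Z]; otherwise a link of [Z] off the
    boundary costs 1 by itself. *)
Lemma odd_cut_wt : odd #|X| -> 1 <= \sum_(x in X) \sum_(y in ~: X) wt x y.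
Proof.
move=> oX; rewrite cut_cost.
(* A vertex split by [X] already contributes at least 1: each of its links
   pays for one copy at least. *)
have [/existsP[v /andP[c1 c2]]|nopart] :=
  boolP [exists v, (0 < nin v)%N && (0 < nout v)%N].
  have bv : (b v)%:R != 0 :> R by rewrite pnatr_eq0 -ninout; case: (nin v) c1.
  rewrite (bigID (fun h => anchor h == v)) /= -[leLHS]addr0.
  apply: lerD; last exact: sumr_ge0.
  rewrite -(divff bv) -{1}p_deg mulr_suml; apply: ler_sum => h /eqP hv.
  rewrite /cost hv -[leLHS]addr0 lerD ?mulr_ge0 ?subr_ge0 //.
  by rewrite ler_peMl ?divr_ge0 // ler1n; case: ifP.
have [Y ninE] : exists Y : {set V}, forall v, nin v = if v \in Y then b v else 0%N.
  exists [set v | (0 < nin v)%N] => v.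
  have := forallP (etrans (esym (negb_exists _)) nopart) v.
  rewrite inE -ninout; case: (nin v) => //= n; rewrite -eqn0Ngt => /eqP->.
  by rewrite addn0.
have noutE v : nout v = if v \in Y then 0%N else b v.
  by have := ninout v; rewrite ninE; case: ifP => _; lia.
have costE h : cost h = ((inr h \in X) != (anchor h \in Y))%:R * p h.1
    + ((inr h \in X) && (inr (flip h) \notin X))%:R * (1 - p h.1).
  rewrite /cost ninE noutE; congr (_ + _).
  by case: (inr h \in X); case: (anchor h \in Y); rewrite ?mul0r // p_div mul1r.
pose Z := [set l | (inr (l, false) \in X) != (inr (l, true) \in X)].
have cardX : #|X| = (\sum_(v in Y) b v +
    \sum_l ((inr (l, false) \in X) + (inr (l, true) \in X)))%N.
  rewrite -sum1_card big_sumType /=; congr (_ + _)%N.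
    rewrite (partition_big kappa predT) //= [RHS]big_mkcond /=.
    apply: eq_bigr => v _; rewrite -ninE sum1_card.
    by apply: eq_card => k; rewrite !inE unfold_in /= andbC.
  rewrite big_mkcond big_pair_bool /=.
  by apply: eq_bigr => l _; case: (inr (l, false) \in X); case: (inr (l, true) \in X).
have oddZ : odd (\sum_l ((inr (l, false) \in X) + (inr (l, true) \in X))) = odd #|Z|.
  rewrite -sum1_card [in RHS]big_mkcond /=.
  apply: (big_ind2 (fun m n => odd m = odd n)) => // [m m' n n' Em En|l _].
    by rewrite !oddD Em En.
  by rewrite inE; case: (inr (l, false) \in X); case: (inr (l, true) \in X).
have [sZ|/subsetPn[l lZ lY]] := boolP (Z \subset boundary Y).
  have := p_cut sZ; rewrite oddD -oddZ -oddD -cardX => /(_ oX) /le_trans; apply.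
  rewrite big_pair_bool big_mkcond /= [X in _ + X]big_mkcond /= -big_split /=.
  apply: ler_sum => l _; rewrite !costE /anchor /flip /= !inE.
  have := p0 l; have := p1 l.
  by case: (inr (l, false) \in X); case: (inr (l, true) \in X);
    case: (en l false \in Y); case: (en l true \in Y) => /= ? ?; lra.
rewrite big_pair_bool (bigD1 l) //= -[leLHS]addr0 lerD //; last first.
  by apply: sumr_ge0 => l' _; rewrite addr_ge0.
move: lZ lY; rewrite !costE /anchor /flip /= !inE negbK.
by case: (inr (l, false) \in X); case: (inr (l, true) \in X);
  case: (en l false \in Y); case: (en l true \in Y) => //= _ _; lra.
Qed.

End Cut.

Lemma exists_bfactor_copies (l0 : L) (c : bool) : (if c then 0 < p l0 else p l0 < 1) ->
  exists F : {set L},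
    [/\ forall l, l \in F -> 0 < p l, forall l, l \notin F -> p l < 1,
        forall v, #|[set h | (anchor h == v) && (h.1 \in F)]| = b v
      & (l0 \in F) = c].
Proof.
move=> Hc.
(* The edge to force at the half [(l0, false)]: to a copy of its anchor if [l0] is to be used, to
   the other half of [l0] if it is to be avoided. *)
have [y [yn wy yc]] : exists y, [/\ inr (l0, false) != y, 0 < wt (inr (l0, false)) y
    & (y != inr (l0, true)) = c].
  case: c Hc => Hc; last first.
    exists (inr (l0, true)); split; [by apply/eqP; case | | by rewrite eqxx].
    by rewrite /wt /flip /= eqxx subr_gt0.
  have b_gt0 : (0 < b (en l0 false))%N.
    rewrite lt0n; apply/negP=> /eqP/(@p_b0 (l0, false)) /= pl.
    by move: Hc; rewrite /= pl ltxx.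
  have : exists k, k \in [set k | kappa k == en l0 false].
    by apply/set0Pn; rewrite -card_gt0 card_kappa.
  case=> k; rewrite inE => /eqP kE; exists (inl k); split=> //=.
  by rewrite /anchor /= kE eqxx divr_gt0 // ltr0n.
have [m [mK mN wm ml0]] := exists_perfect_matching_through wtC wt0 wt1 odd_cut_wt yn wy.
pose F := [set l | m (inr (l, false)) != inr (l, true)].
have inF h : (h.1 \in F) = (m (inr h) != inr (flip h)).
  case: h => l [] /=; rewrite inE //; congr (~~ _).
  by rewrite (inv_eq mK) eq_sym.
have half h : if h.1 \in F
    then 0 < p h.1 /\ (exists2 k, m (inr h) = inl k & kappa k = anchor h)
    else p h.1 < 1.
  have := wm (inr h); rewrite inF; case: (m (inr h)) => [k|h'] /=.
    case: eqP => [hk|]; last by rewrite ltxx.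
    move=> H; split; last by exists k.
    by rewrite lt0r p0 andbT; apply: contraTneq H => ->; rewrite mul0r ltxx.
  by case: eqP => [->|]; rewrite ?ltxx // eqxx /= subr_gt0.
exists F; split.
- by move=> l lF; have := half (l, false); rewrite /= lF => -[].
- by move=> l lF; have := half (l, false); rewrite /= (negPf lF).
(* [m] maps the halves at [v] of links in [F] bijectively onto the copies of [v]. *)
- move=> v; rewrite -card_kappa -(card_imset _ (@inl_inj K (L * bool))).
  rewrite -(card_in_imset (f := fun h => m (inr h))); last first.
    by move=> h h' _ _ /(can_inj mK)[].
  apply: eq_card => x; apply/imsetP/imsetP => -[].
    move=> h; rewrite inE => /andP[/eqP hv hF] ->.
    have := half h; rewrite hF => -[_ [k -> kh]].
    by exists k => //; rewrite inE kh hv.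
  move=> k; rewrite inE => /eqP kv ->; have := wm (inl k).
  case E : (m (inl k)) => [k'|h] /=; first by rewrite ltxx.
  case: eqP => [hk _|]; last by rewrite ltxx.
  have mh : m (inr h) = inl k by rewrite -E mK.
  by exists h; rewrite // inE hk kv eqxx inF mh.
- by rewrite inE ml0.
Qed.

End BFactor.

Lemma exists_bfactor (R : realFieldType) (V L : finType) (en : L -> bool -> V)
    (p : L -> R) (b : V -> nat) :
  (forall l, 0 <= p l) -> (forall l, p l <= 1) ->
  (forall v, \sum_(h | en h.1 h.2 == v) p h.1 = (b v)%:R) ->
  (forall (Y : {set V}) (D : {set L}), D \subset boundary en Y ->
     odd (\sum_(v in Y) b v + #|D|) ->
     1 <= \sum_(l in boundary en Y :\: D) p l + \sum_(l in D) (1 - p l)) ->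
  forall (l0 : L) (c : bool), (if c then 0 < p l0 else p l0 < 1) ->
  exists F : {set L},
    [/\ forall l, l \in F -> 0 < p l, forall l, l \notin F -> p l < 1,
        forall v, #|[set h | (en h.1 h.2 == v) && (h.1 \in F)]| = b v
      & (l0 \in F) = c].
Proof.
move=> p0 p1 pd pc l0 c; have [K [kappa Kb]] := exists_fibers b.
exact: (exists_bfactor_copies p0 p1 pd pc Kb).
Qed.

(** * Parity factors *)

Lemma natrZ2 (n : nat) : n%:R = (odd n)%:R :> 'Z_2.
Proof.
have Z22 : 2%:R = 0 :> 'Z_2 by apply/val_inj.
by rewrite -[in LHS](odd_double_half n) natrD -mul2n natrM Z22 mul0r addr0.
Qed.

Lemma opprZ2 (a : 'Z_2) : - a = a.
Proof. by apply/val_inj; case: a => [[|[|]]]. Qed.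

(** The window contains the consecutive integers [k + 1] and [k + 2], where [k] is the integer part
    of [x]. *)
Lemma exists_parity_window (R : realType) (x : R) (a : 'Z_2) : 0 <= x ->
  exists b : nat, [/\ b%:R = a, x < b%:R & b%:R <= x + 2].
Proof.
move=> x0; have /andP[lek gtk] := truncn_itv x0.
set k := Num.truncn x in lek gtk; have kS : k.+1%:R = k%:R + 1 :> R by rewrite -natr1.
have kSS : k.+2%:R = k%:R + 2 :> R by rewrite -addn2 natrD.
have [ka|ka] := eqVneq (k.+1%:R : 'Z_2) a.
  by exists k.+1; split; [| lra | lra].
exists k.+2; split; [| lra | lra].
move: ka; rewrite (natrZ2 k.+1) (natrZ2 k.+2) /=.
have [->|->] : a = 0 \/ a = 1.
  by case: a => [[|[|]]] // i; [left | right]; apply/val_inj.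
all: by case: (odd k); rewrite ?eqxx.
Qed.

(** For [0 < j < n] both kinds of terms occur and already give [eps + (1 - eps) = 1]; only the
    extreme values of [j] rely on the two hypotheses. *)
Lemma cut_cost_ge1 (R : realFieldType) (eps : R) (n j : nat) :
  0 < eps -> eps < 1 -> (j <= n)%N ->
  (j = 0%N -> 1 <= eps * n%:R) -> (j = n -> 1 <= (1 - eps) * n%:R) ->
  1 <= eps * (n - j)%:R + (1 - eps) * j%:R.
Proof.
move=> e0 e1 jn H0 Hn; have [j0|j0] := eqVneq j 0%N.
  by rewrite j0 subn0 mulr0 addr0 H0.
have [jnE|jn'] := eqVneq j n; first by rewrite jnE subnn mulr0 add0r Hn.
have J1 : 1 <= j%:R :> R by rewrite ler1n lt0n.
have N1 : 1 <= (n - j)%:R :> R by rewrite ler1n subn_gt0 ltn_neqAle jn' jn.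
have : eps * 1 + (1 - eps) * 1 <= eps * (n - j)%:R + (1 - eps) * j%:R.
  by apply: lerD; apply: ler_wpM2l => //; lra.
by apply: le_trans; lra.
Qed.

(** Edges inside [Y] are counted twice, cut edges once. *)
Lemma odd_sum_deg (G : multigraph) (Y : {set vertex G}) :
  odd (\sum_(v in Y) deg v) = odd (cut_deg Y).
Proof.
rewrite /deg /sub_deg exchange_big /=.
under eq_bigl do rewrite inE.
rewrite /cut_deg -sum1_card [in RHS]big_mkcond /=.
apply: (big_ind2 (fun m n => odd m = odd n)) => // [m m' n n' Em En|e _].
  by rewrite !oddD Em En.
have cnt u : (\sum_(v in Y) (u == v) = (u \in Y))%N.
  have [uY|uY] := boolP (u \in Y).
    by rewrite (bigD1 u) //= eqxx big1 // => v /andP[_ /negPf]; rewrite eq_sym => ->.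
  by rewrite big1 // => v vY; case: eqP uY => // ->; rewrite vY.
rewrite inE big_split /= !cnt.
by case: (_ \in Y); case: (_ \in Y).
Qed.

Section Application.
Variables (R : realType) (G : multigraph) (f : vertex G -> 'Z_2) (eps : R).
Hypothesis f_even : \sum_(v : vertex G) f v = 0.
Hypotheses (eps_gt0 : 0 < eps) (eps_lt1 : eps < 1).
Hypothesis cut_f : forall X : {set vertex G}, X != set0 -> X != [set: vertex G] ->
  \sum_(v in X) f v = 1 -> 1 / eps <= (cut_deg X)%:R.
Hypothesis cut_df : forall X : {set vertex G}, X != set0 -> X != [set: vertex G] ->
  \sum_(v in X) ((deg v)%:R - f v) = 1 -> 1 / (1 - eps) <= (cut_deg X)%:R.

(** If [j = 0], the sum of [f] over [Y] is odd; if [j = cut_deg Y], the sum of [deg - f] is. These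
    are the two cut hypotheses. [Y] is nonempty and proper because otherwise its cut is empty and
    its sum of [f] is 0. *)
Lemma parity_cut_bound (Y : {set vertex G}) (b : vertex G -> nat) (j : nat) :
  (forall v, (b v)%:R = f v) -> (j <= cut_deg Y)%N ->
  odd (\sum_(v in Y) b v + j) ->
  1 <= eps * (cut_deg Y - j)%:R + (1 - eps) * j%:R.
Proof.
move=> bf jn odd_bj.
have fY : \sum_(v in Y) f v = (odd (\sum_(v in Y) b v))%:R.
  by rewrite -natrZ2 natr_sum; apply: eq_bigr => v _; rewrite bf.
have dY : \sum_(v in Y) ((deg v)%:R - f v) = (odd (\sum_(v in Y) b v + cut_deg Y))%:R.
  have dE : \sum_(v in Y) (deg v)%:R = (cut_deg Y)%:R :> 'Z_2.
    by rewrite -natr_sum natrZ2 odd_sum_deg -natrZ2.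
  rewrite -natrZ2 natrD natr_sum sumrB dE addrC -sumrN.
  by congr (_ + _); apply: eq_bigr => v _; rewrite opprZ2 bf.
have fT : \sum_(v in [set: vertex G]) f v = 0.
  by rewrite -[RHS]f_even; apply: eq_bigl => v; rewrite inE.
apply: cut_cost_ge1 => // [j0|jE].
  rewrite -ler_pdivrMl // mulrC; apply: cut_f; last first.
  - by rewrite fY; move: odd_bj; rewrite j0 addn0 => ->.
  - apply: contraTneq odd_bj => YT; move: fY; rewrite j0 addn0 YT.
    by rewrite fT; case: odd.
  - by apply: contraTneq odd_bj => ->; rewrite j0 big_set0.
rewrite -ler_pdivrMl ?subr_gt0 // mulrC; apply: cut_df; last first.
- by rewrite dY -jE odd_bj.
- apply: contraTneq odd_bj => YT; rewrite jE; move: fY.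
  have -> : cut_deg Y = 0%N.
    by apply/eqP; rewrite cards_eq0; apply/eqP/setP=> e; rewrite YT !inE.
  by rewrite addn0 YT fT; case: odd.
- apply: contraTneq odd_bj => Y0; rewrite jE Y0 big_set0.
  have -> // : cut_deg (set0 : {set vertex G}) = 0%N.
  by apply/eqP; rewrite cards_eq0; apply/eqP/setP=> e; rewrite !inE.
Qed.

Lemma exists_near_eps_factor (z : vertex G) (c : bool) : exists F : {set edge G},
  [/\ parity_factor f F, near_eps_degrees eps F &
      if c then (sub_deg F z)%:R <= eps * (deg z)%:R
      else eps * (deg z)%:R <= (sub_deg F z)%:R].
Proof.
have ed0 (v : vertex G) : 0 <= eps * (deg v)%:R by rewrite mulr_ge0 // ltW.
have /fin_all_exists[b Hb] v := exists_parity_window (f v) (ed0 v).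
pose en (l : edge G + vertex G) (s : bool) :=
  match l with inl e => if s then (ends e).2 else (ends e).1 | inr v => v end.
(* The loop at [v] counts twice, hence the division by 2 of the deficit [b v - eps * deg v]. *)
pose p (l : edge G + vertex G) : R :=
  match l with inl e => eps | inr v => ((b v)%:R - eps * (deg v)%:R) / 2 end.
have p0 l : 0 <= p l.
  by case: l => [e|v] /=; [exact: ltW | have [_ ? _] := Hb v; lra].
have p1 l : p l <= 1.
  by case: l => [e|v] /=; [exact: ltW | have [_ _ ?] := Hb v; lra].
have p_deg v : \sum_(h | en h.1 h.2 == v) p h.1 = (b v)%:R.
  rewrite big_mkcond big_pair_bool big_sumType /= [X in _ + X](bigD1 v) //=.
  rewrite eqxx [X in _ + (_ + X)]big1 => [|u /negPf->]; last by rewrite addr0.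
  have -> : \sum_e ((if (ends e).1 == v then eps else 0)
                    + (if (ends e).2 == v then eps else 0))
     = eps * (deg v)%:R.
    rewrite /deg /sub_deg natr_sum mulr_sumr; apply: eq_big => [e|e _].
      by rewrite inE.
    by rewrite natrD; case: eqP; case: eqP => _ _ /=; rewrite ?mulrDr ?mulr1 ?mulr0.
  by rewrite addr0; lra.
have p_cut (Y : {set vertex G}) (D : {set edge G + vertex G}) : D \subset boundary en Y ->
    odd (\sum_(v in Y) b v + #|D|) ->
    1 <= \sum_(l in boundary en Y :\: D) p l + \sum_(l in D) (1 - p l).
  move=> sD oD.
  have cE : #|boundary en Y| = cut_deg Y.
    rewrite /cut_deg -[RHS](card_imset _ (@inl_inj (edge G) (vertex G))).
    apply: eq_card => -[e|v].
      by rewrite (mem_imset _ _ (@inl_inj _ _)) !inE.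
    rewrite inE eqxx; apply/esym/negP=> /imsetP[] //.
  (* Loops never cross a boundary, so only original edges, of weight [eps], occur there. *)
  have pE l : l \in boundary en Y -> p l = eps.
    by case: l => [//|v]; rewrite inE eqxx.
  have := parity_cut_bound (fun v => let: And3 H _ _ := Hb v in H) (j := #|D|) _ oD.
  rewrite -cE subset_leq_card // => /(_ isT); rewrite -cardsDS // => /le_trans; apply.
  rewrite (eq_bigr (fun=> eps)) => [|l]; last by case/setDP=> /pE.
  rewrite [X in _ <= _ + X](eq_bigr (fun=> 1 - eps)) => [|l lD]; last first.
    by rewrite pE // (subsetP sD).
  by rewrite !sumr_const !mulr_natr.
(* For the upper bound at [z] its loop must be used, for the lower bound avoided. Avoiding it is
   impossible when its weight is 1, but then [b z - 2 = eps * deg z] and using it gives equality. *)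
have [l0 [c' [Hl Hc]]] : exists l0 c', (if c' then 0 < p l0 else p l0 < 1) /\
   (c = c' /\ l0 = inr z \/ c = false /\ p (inr z) = 1).
  have [_ z1 z2] := Hb z; case: c.
    by exists (inr z), true; split; [rewrite /=; lra | left].
  have [pz|pz] := eqVneq (p (inr z)) 1.
    by exists (inr z), true; split; [rewrite pz | right].
  by exists (inr z), false; split; [rewrite lt_neqAle pz p1 | left].
have [F [F0 F1 degF Fl]] := exists_bfactor p0 p1 p_deg p_cut Hl.
pose F' := [set e | inl e \in F].
have dF v : (sub_deg F' v + 2 * (inr v \in F))%N = b v.
  rewrite -degF -sum1_card big_mkcond big_pair_bool big_sumType /=.
  congr (_ + _)%N.
    rewrite /sub_deg big_mkcond; apply: eq_bigr => e _; rewrite !inE /=.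
    by case: (inl e \in F); rewrite ?andbF //= !andbT; do 2 case: eqP.
  rewrite (bigD1 v) //= big1 => [|u uv]; rewrite !inE ?eqxx ?(negPf uv) //=.
  by case: (_ \in F).
have dF' v : (sub_deg F' v)%:R = (b v)%:R - 2 * (inr v \in F)%:R :> R.
  by rewrite -dF natrD natrM addrK.
exists F'; split.
- move=> v; have [<- _ _] := Hb v; rewrite -dF natrD natrM.
  by rewrite [2%:R](_ : _ = 0) ?mul0r ?addr0 //; apply/val_inj.
(* Strictness on both sides is what yields the floor minus 1 and the ceiling plus 1. Without the
   loop it comes from the loop weight being less than 1. *)
- have near v : eps * (deg v)%:R - 2 < (sub_deg F' v)%:R < eps * (deg v)%:R + 2.
    rewrite dF'; have [_ b1 b2] := Hb v; have [vF|vF] := boolP (inr v \in F).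
      by apply/andP; split; rewrite mulr1; lra.
    by have := F1 _ vF; rewrite /= => pv; apply/andP; split; rewrite mulr0; lra.
  move=> v; have /andP[lo hi] := near v.
  have fl : Num.floor (eps * (deg v)%:R) < (sub_deg F' v)%:Z + 2.
    by rewrite floor_lt_int intrD; lra.
  have ce : (sub_deg F' v)%:Z - 2 < Num.ceil (eps * (deg v)%:R).
    by rewrite ceil_gt_int intrB; lra.
  by clear -fl ce; apply/andP; split; lia.
- rewrite dF'; have [_ b1 b2] := Hb z.
  case: Hc => [[-> lz]|[-> pz]].
    rewrite -lz Fl; case: (c') => /=; lra.
  have zF : inr z \in F by apply: contraT => /F1; rewrite pz ltxx.
  by rewrite zF /=; move: pz => /=; lra.
Qed.
End Application.

Theorem theorem5p5 (R : realType) (G : multigraph) (f : vertex G -> 'Z_2)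
    (eps : R)
    (G_connected : connected_graph G)
    (f_even : \sum_(v : vertex G) f v = 0)
    (eps_gt0 : 0 < eps) (eps_lt1 : eps < 1)
    (cut_f : forall X : {set vertex G}, X != set0 -> X != [set: vertex G] ->
       \sum_(v in X) f v = 1 -> 1 / eps <= (cut_deg X)%:R)
    (cut_df : forall X : {set vertex G}, X != set0 -> X != [set: vertex G] ->
       \sum_(v in X) ((deg v)%:R - f v) = 1 -> 1 / (1 - eps) <= (cut_deg X)%:R) :
  (exists F : {set edge G}, parity_factor f F /\ near_eps_degrees eps F) /\
  (forall z : vertex G,
     (exists F : {set edge G},
        [/\ parity_factor f F, near_eps_degrees eps F &
            eps * (deg z)%:R <= (sub_deg F z)%:R]) /\
     (exists F : {set edge G},
        [/\ parity_factor f F, near_eps_degrees eps F &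
            (sub_deg F z)%:R <= eps * (deg z)%:R])).
Proof.
have main := exists_near_eps_factor f_even eps_gt0 eps_lt1 cut_f cut_df.
split=> [|z]; last by split; [exact: main z false | exact: main z true].
case: (pickP (vertex G)) => [z _|V0].
  by have [F [HF nF _]] := main z true; exists F.
by exists set0; split=> v; have := V0 v.
Qed.
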